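(* Each of the measures $\mu_t$, $0<t<\infty$, is quasiinvariant with respect to the action of $G$ on the space $\mathfrak S$. More precisely, for every $g\in G$, $$\frac{\mu_t(dx\cdot g)}{\mu_t(dx)}=t^{c(x,g)},\qquad x\in\mathfrak S,$$ that is, $\mu_t(V\cdot g)=\int_V t^{c(x,g)}\,\mu_t(dx)$ for every Borel set $V\subseteq\mathfrak S$. The measures $\mu_0$ and $\mu_\infty$ are not quasiinvariant.
   Context: $S(n)$ is the group of permutations of $\{1,\dots,n\}$, identified with the stabilizer of $n+1$ in $S(n+1)$; $S(\infty)=\bigcup_n S(n)$; $G=S(\infty)\times S(\infty)$, $G(n)=S(n)\times S(n)$. The canonical projection $p_{n,n+1}:S(n+1)\to S(n)$ removes $n+1$ from its cycle: for $1\le i\le n$, $(p_{n,n+1}(x))(i)=x(i)$ if $x(i)\le n$, and $=x(n+1)$ if $x(i)=n+1$. $\mathfrak S=\varprojlim S(n)$ is the compact space of sequences $x=(x_n)$, $x_n\in S(n)$, $p_{n,n+1}(x_{n+1})=x_n$; $p_n:\mathfrak S\to S(n)$ is $x\mapsto x_n$. $G$ acts on $\mathfrak S$ on the right: for $g=(g_1,g_2)$, $x\cdot g=y$ where $y_n=g_2^{-1}x_ng_1$ for all $n$ with $g\in G(n)$. For $s\in S(n)$, $[s]$ is the number of cycles of $s$ (fixed points included). The fundamental cocycle $c(x,g)\in\mathbb Z$ ($x\in\mathfrak S$, $g\in G$) is $c(x,g)=[p_n(x\cdot g)]-[p_n(x)]$ for any $n$ so large that $g\in G(n)$; this does not depend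 on such $n$. For $0<t<\infty$, $\mu_t^n$ is the probability measure on $S(n)$ with $\mu_t^n(\{x\})=\dfrac{t^{[x]}}{t(t+1)\cdots(t+n-1)}$. These are consistent with the canonical projections, and $\mu_t=\varprojlim\mu_t^n$ is the Borel probability measure on $\mathfrak S$ whose image under $p_n$ is $\mu_t^n$ for every $n$. $\mu_0$ and $\mu_\infty$ are the weak limits of $\mu_t$ as $t\to0$ and $t\to+\infty$: the image of $\mu_0$ under $p_n$ is the uniform distribution on $n$-cycles in $S(n)$, and $\mu_\infty$ is the Dirac measure at the identity $e\in S(\infty)\subset\mathfrak S$ (the sequence of identity permutations). A measure is quasiinvariant if it is equivalent to each of its shifts by elements $g\in G$. *)

(* Defs.v *)
From HB Require Import structures.
From mathcomp Require Import all_boot all_order all_fingroup all_algebra.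
From mathcomp Require Import all_classical all_reals all_analysis.

Set Implicit Arguments.
Unset Strict Implicit.
Unset Printing Implicit Defensive.

Import Order.TTheory GRing.Theory Num.Theory.
Import numFieldNormedType.Exports.

Local Open Scope classical_set_scope.
Local Open Scope ring_scope.

(* S(n) is 'S_n, the permutations of 'I_n = {0, ..., n-1}: the points are
   numbered from 0, and the point n+1 of {1, ..., n+1} is ord_max : 'I_n.+1.
   MathComp composes permutations from left to right: (s * t)%g i = t (s i). *)

(* The default value i of insubd is never used: if x i = ord_max, then
   x ord_max < n because x is injective. *)
Definition canproj_fun n (x : 'S_n.+1) (i : 'I_n) : 'I_n :=
  let j := x (widen_ord (leqnSn n) i) in
  insubd i (if (j < n)%N then j : nat else x ord_max : nat).

Lemma canproj_funE n (x : 'S_n.+1) (i : 'I_n) :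
  let j := x (widen_ord (leqnSn n) i) in
  canproj_fun x i = (if (j < n)%N then j else x ord_max) :> nat.
Proof.
move=> j; rewrite /canproj_fun -/j val_insubd.
case: (ltnP j n) => [jn|nj]; first by rewrite jn.
case: ifP => // /negbT; rewrite -leqNgt => nm.
have /perm_inj/(congr1 val)/= : j = x ord_max.
  apply/val_inj/eqP; rewrite /= eqn_leq.
  by rewrite (leq_trans _ nm) ?(leq_trans _ nj) ?leq_ord // -ltnS.
by move=> e; have := ltn_ord i; rewrite e ltnn.
Qed.

Lemma canproj_fun_inj n (x : 'S_n.+1) : injective (canproj_fun x).
Proof.
have ordm (a b : 'I_n.+1) : (n <= a)%N -> (n <= b)%N -> a = b.
  move=> na nb; apply/val_inj/eqP; rewrite eqn_leq.
  by rewrite (leq_trans _ nb) ?(leq_trans _ na) ?leq_ord.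
have wid_max (i : 'I_n) : widen_ord (leqnSn n) i <> ord_max.
  by move=> /(congr1 val)/= e; have := ltn_ord i; rewrite e ltnn.
move=> i k /(congr1 val); rewrite /= !canproj_funE.
case: ltnP => hi; case: ltnP => hk e.
- by move/val_inj/perm_inj/(congr1 val): e => /= /val_inj.
- by move/val_inj/perm_inj: e => /wid_max.
- by move/val_inj/perm_inj/esym: e => /wid_max.
- by have /perm_inj/(congr1 val)/= /val_inj := ordm _ _ hi hk.
Qed.

Definition canproj n (x : 'S_n.+1) : 'S_n := perm (@canproj_fun_inj n x).

(* The inverse limit, with the topology induced by the product of the discrete
   topologies. The additional factor 'S_0 is a singleton. *)
Definition coherent :
    set (prod_topology (fun n : nat => discrete_topology 'S_n)) :=
  [set x | forall n, @canproj n (x n.+1) = x n].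

Definition vperm : Type := set_type coherent.

HB.instance Definition _ := Topological.copy vperm (set_type coherent).

Definition vperm_of x (cx : coherent x) : vperm :=
  exist (fun x => x \in coherent) x (mem_set cx).

Definition vproj n (x : vperm) : 'S_n := val x n.

Lemma vproj_coherent n (x : vperm) : canproj (vproj n.+1 x) = vproj n x.
Proof. exact: (set_mem (valP x)). Qed.

Lemma canproj1 n : canproj (1%g : 'S_n.+1) = 1%g.
Proof.
apply/permP => i; apply/val_inj; rewrite /= permE canproj_funE !perm1 /=.
by rewrite ltn_ord.
Qed.

Lemma coherent1 : coherent (fun n => 1%g : 'S_n).
Proof. by move=> n; exact: canproj1. Qed.

Definition vone : vperm := vperm_of coherent1.

HB.instance Definition _ := isPointed.Build vperm vone.

HB.instance Definition _ :=
  @isMeasurable.Build (sigma_display (@open vperm)) vperm <<s @open vperm >>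
    (@sigma_algebra0 _ setT _) (@sigma_algebraC _ _)
    (@sigma_algebra_bigcup _ setT _).

Definition fixes_from (n : nat) (f : nat -> nat) : Prop :=
  forall i : nat, (n <= i)%N -> f i = i.

Record Sinf := MkSinf {
  sinf_fun :> nat -> nat ;
  sinf_bij : bijective sinf_fun ;
  sinf_fin : exists n, fixes_from n sinf_fun }.

Definition Ginf : Type := (Sinf * Sinf)%type.

Definition in_G (n : nat) (g : Ginf) : Prop :=
  fixes_from n g.1 /\ fixes_from n g.2.

(* The restriction of f to {0, ..., n-1}; the default values are irrelevant
   as soon as f fixes every i >= n, see restrE below. *)
Definition restr (n : nat) (f : Sinf) : 'S_n :=
  insubd (1%g : 'S_n) [ffun i : 'I_n => insubd i (f i)].

Lemma fixes_from_ltn n (f : Sinf) i :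
  fixes_from n f -> (i < n)%N -> (f i < n)%N.
Proof.
move=> fn ilt; rewrite ltnNge; apply/negP => nfi.
have /(bij_inj (sinf_bij f)) e := fn _ nfi.
by move: nfi; rewrite e leqNgt ilt.
Qed.

Lemma restrE n (f : Sinf) (i : 'I_n) : fixes_from n f -> restr n f i = f i :> nat.
Proof.
move=> fn.
have fE (j : 'I_n) : [ffun i : 'I_n => insubd i (f i)] j = f j :> nat.
  by rewrite ffunE val_insubd fixes_from_ltn.
rewrite /restr -pvalE val_insubd ifT ?fE //.
apply/injectiveP => j k /(congr1 val); rewrite /= !fE.
by move/(bij_inj (sinf_bij f))/val_inj.
Qed.

(* g_2^-1 o x_n o g_1 *)
Definition act_level n (x : vperm) (g : Ginf) : 'S_n :=
  (restr n g.1 * vproj n x * (restr n g.2)^-1)%g.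

(* The point y = x . g; it exists and is unique, see vactE and vact_unique. *)
Definition vact (x : vperm) (g : Ginf) : vperm :=
  get [set y : vperm | forall n, in_G n g -> vproj n y = act_level n x g].

Lemma in_GS n g : in_G n g -> in_G n.+1 g.
Proof. by move=> [h1 h2]; split=> i /ltnW; [exact: h1 | exact: h2]. Qed.

Lemma in_G_leq m n g : (m <= n)%N -> in_G m g -> in_G n g.
Proof.
move=> mn [h1 h2]; split=> i ni; [exact/h1/(leq_trans mn) | exact/h2/(leq_trans mn)].
Qed.

Lemma in_G_ex g : exists n, in_G n g.
Proof.
have [[m hm] [n hn]] := (sinf_fin g.1, sinf_fin g.2).
by exists (maxn m n); split=> i; rewrite geq_max => /andP[mi ni];
  [exact: hm | exact: hn].
Qed.

Lemma act_level_coherent n x g : in_G n g ->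
  canproj (act_level n.+1 x g) = act_level n x g.
Proof.
move=> gn; have [h1 h2] := gn; have [k1 k2] := in_GS gn.
have wr (f : Sinf) (i : 'I_n) : fixes_from n f -> fixes_from n.+1 f ->
    restr n.+1 f (widen_ord (leqnSn n) i) = widen_ord (leqnSn n) (restr n f i).
  by move=> fn fn1; apply/val_inj; rewrite /= !restrE.
have mr (f : Sinf) : fixes_from n f -> fixes_from n.+1 f ->
    restr n.+1 f ord_max = ord_max.
  by move=> fn fn1; apply/val_inj; rewrite /= restrE //= fn.
have lr (f : Sinf) (j : 'I_n.+1) (z : 'I_n) : fixes_from n f ->
    fixes_from n.+1 f -> j = restr n f z :> nat ->
    ((restr n.+1 f)^-1)%g j = z :> nat.
  move=> fn fn1 e; have -> : j = restr n.+1 f (widen_ord (leqnSn n) z).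
    by rewrite wr //; exact/val_inj.
  by rewrite permK.
apply/permP => i; apply/val_inj; rewrite /= permE canproj_funE /act_level.
rewrite !permM wr // mr //.
set i1 := restr n g.1 i; set z := ((restr n g.2)^-1 _)%g.
have zE : restr n g.2 z = vproj n x i1 by rewrite /z permKV.
have := canproj_funE (vproj n.+1 x) i1.
have -> : canproj_fun (vproj n.+1 x) i1 = vproj n x i1.
  by rewrite -(vproj_coherent n x) permE.
rewrite /= -zE; case: ifP => hj zj.
  have e : ((restr n.+1 g.2)^-1)%g (vproj n.+1 x (widen_ord (leqnSn n) i1)) = z
      :> nat by exact: lr.
  by rewrite e ltn_ord.
have -> : vproj n.+1 x (widen_ord (leqnSn n) i1) = ord_max.
  apply/val_inj/eqP; rewrite /= eqn_leq -ltnS ltn_ord /=.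
  by rewrite leqNgt hj.
have -> : ((restr n.+1 g.2)^-1)%g ord_max = ord_max.
  by rewrite -{1}(mr g.2) // permK.
by rewrite /= ltnn; exact: lr.
Qed.

Lemma coherent_extend (N : nat) (a : forall n, 'S_n) :
  (forall n, (N <= n)%N -> canproj (a n.+1) = a n) ->
  exists y : vperm, forall n, (N <= n)%N -> vproj n y = a n.
Proof.
elim: N a => [|N IH] a ha.
  have ca : coherent a by move=> n; exact: ha.
  by exists (vperm_of ca).
pose b n : 'S_n := if n == N then canproj (a n.+1) else a n.
have [|y hy] := IH b.
  move=> n; rewrite /b (leq_eqVlt N) => /predU1P[<-|Nn].
    by rewrite eqxx gtn_eqF.
  by rewrite !gtn_eqF ?ha // ltnS ltnW.
by exists y => n Nn; rewrite hy ?(ltnW Nn) // /b gtn_eqF.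
Qed.

Lemma vactE n x g : in_G n g -> vproj n (vact x g) = act_level n x g.
Proof.
pose P := [set y : vperm | forall n, in_G n g -> vproj n y = act_level n x g].
move: n; apply: (@getPex _ P).
have exN : exists n, `[< in_G n g >].
  by have [n gn] := in_G_ex g; exists n; exact/asboolP.
case: (ex_minnP exN) => N /asboolP gN minN.
have [|y hy] := @coherent_extend N (fun n => act_level n x g).
  by move=> n Nn; apply: act_level_coherent; exact: in_G_leq gN.
by exists y => n gn; rewrite hy //; apply/minN/asboolP.
Qed.

Lemma vact_unique x g y :
  (forall n, in_G n g -> vproj n y = act_level n x g) -> y = vact x g.
Proof.
move=> hy; have [N gN] := in_G_ex g.
have eN n : (N <= n)%N -> vproj n y = vproj n (vact x g).
  by move=> Nn; have gn := in_G_leq Nn gN; rewrite hy // vactE.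
suff e n : vproj n y = vproj n (vact x g).
  by apply/val_inj/functional_extensionality_dep => n; exact: e.
have [k] : exists k, (N <= k + n)%N by exists N; rewrite leq_addr.
elim: k n => [|k IH] n; first exact: eN.
by rewrite addSnnS => /IH e; rewrite -vproj_coherent e vproj_coherent.
Qed.

Definition ncycles n (s : 'S_n) : nat := #|porbits s|.

Definition level (g : Ginf) : nat := get [set n | in_G n g].

Lemma levelP g : in_G (level g) g.
Proof. by apply: (@getPex _ [set n | in_G n g]); exact: in_G_ex. Qed.

(* The value is the same at every level n such that g is in G(n). *)
Definition cocycle (x : vperm) (g : Ginf) : int :=
  (ncycles (vproj (level g) (vact x g)))%:Z - (ncycles (vproj (level g) x))%:Z.

Section measures.
Variable R : realType.

Definition ewens (t : R) n (s : 'S_n) : R :=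
  t ^+ ncycles s / \prod_(i < n) (t + i%:R).

(* m is mu_t: its image under each p_n is mu_t^n. *)
Definition is_ewens_limit (t : R) (m : probability vperm R) : Prop :=
  forall n (A : {set 'S_n}),
    m (@vproj n @^-1` [set` A]) = (\sum_(s in A) ewens t s)%:E.

Definition weak_limit (mu : R -> probability vperm R) (F : set_system R)
    (nu : probability vperm R) : Prop :=
  forall f : vperm -> R, continuous f -> bounded_fun f ->
    (\int[mu t]_x (f x)%:E)%E @[t --> F] --> (\int[nu]_x (f x)%:E)%E.

Definition vshift (V : set vperm) (g : Ginf) : set vperm :=
  [set vact x g | x in V].

Definition shift_measure (m : probability vperm R) (g : Ginf) :
    set vperm -> \bar R :=
  fun V => m (vshift V g).

Definition quasiinvariant (m : probability vperm R) : Prop :=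
  forall g : Ginf, m `<< shift_measure m g /\ shift_measure m g `<< m.

End measures.

(* Main.v *)
Require Import Defs.
From HB Require Import structures.
From mathcomp Require Import all_boot all_order all_fingroup all_algebra.
From mathcomp Require Import all_classical all_reals all_analysis.
From mathcomp Require Import measurable_realfun.

Import Order.TTheory GRing.Theory Num.Theory.
Import numFieldNormedType.Exports.

Local Open Scope classical_set_scope.
Local Open Scope ring_scope.

(** The weight of s in S(n) under the Ewens measure is t to the number of cycles
    of s, up to a factor that depends only on n.  An element g of G(n) permutes
    S(n), hence carries the fiber over s of the projection p_n to the fiber over
    s . g, and multiplies its measure by t^([s . g] - [s]).  This exponent is
    the cocycle, which is the same at all levels n with g in G(n)
    (ncycles_vact_cst): the projection from S(n+1) to S(n) loses a cycle exactly
    when the last point is fixed (ncycles_canproj), and g fixes that point.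

    So the shifted measure and the measure with density t^c agree on all fibers
    of high level.  As the space is a limit of finite sets, unions of fibers of
    one level form a pi-system that generates the Borel sets
    (measurable_vpermE), and the two measures are equal (ewens_vshift).
    Quasiinvariance follows: a null set has integral 0, and the action of the
    inverse of g gives the converse.

    A quasiinvariant probability measure charges every fiber, because G(n) acts
    transitively on S(n) (quasiinvariant_fiber_neq0).  Fibers are clopen, so weak
    limits pass to their measures (weak_limit_fiber), and already in S(2) the
    limit at 0 gives measure 0 to the identity and the limit at infinity gives
    measure 0 to the transposition. *)

(** * Cycles and the canonical projection *)

Lemma expg_lift_perm n (i : 'I_n.+1) (s : 'S_n) k :
  ((lift_perm i i s ^+ k) = lift_perm i i (s ^+ k))%g.
Proof.
elim: k => [|k IH]; first by rewrite !expg0 lift_perm1.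
by rewrite !expgSr IH lift_permM.
Qed.

Lemma porbit_lift_perm n (i : 'I_n.+1) (s : 'S_n) (j : 'I_n) :
  porbit (lift_perm i i s) (lift i j) = lift i @: porbit s j.
Proof.
apply/setP => k; apply/porbitP/imsetP => [[e ->]|[l /porbitP[e ->] ->]].
  by exists ((s ^+ e)%g j); rewrite ?mem_porbit ?expg_lift_perm ?lift_perm_lift.
by exists e; rewrite expg_lift_perm lift_perm_lift.
Qed.

Lemma porbit_lift_perm_id n (i : 'I_n.+1) (s : 'S_n) :
  porbit (lift_perm i i s) i = [set i]%SET.
Proof.
apply/setP => k; rewrite inE; apply/porbitP/eqP => [[e ->]|->].
  by rewrite expg_lift_perm lift_perm_id.
by exists 0; rewrite expg0 perm1.
Qed.

Lemma ncycles_lift_perm n (i : 'I_n.+1) (s : 'S_n) :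
  ncycles (lift_perm i i s) = (ncycles s).+1.
Proof.
have -> : ncycles (lift_perm i i s) =
    #|[set i]%SET |: [set lift i @: B | B : {set 'I_n} in porbits s]|.
  congr #|pred_of_set _|; apply/setP => B; rewrite !inE.
  apply/imsetP/orP => [[k _ ->]|[/eqP->|/imsetP[C /imsetP[j _ ->] ->]]].
  - case: (unliftP i k) => [j ->|->]; [right|left].
      by rewrite porbit_lift_perm imset_f ?imset_f.
    by rewrite porbit_lift_perm_id.
  - by exists i => //; rewrite porbit_lift_perm_id.
  - by exists (lift i j) => //; rewrite porbit_lift_perm.
rewrite cardsU1 card_imset; last exact/imset_inj/lift_inj.
rewrite (_ : _ \notin _) //; apply/imsetP => -[C _ /setP/(_ i)].
rewrite inE eqxx => /esym/imsetP[j _ e].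
by have := neq_lift i j; rewrite -e eqxx.
Qed.

(** Removing the last point m from its cycle turns m into a fixed point and leaves
    the other points in their cyclic order, so seen in S(n+1) it is the
    multiplication of x by the transposition of m and x^-1 m.  These two
    points lie on one cycle of x, so the multiplication splits that cycle in
    two unless m is already fixed. *)
Lemma ncycles_canproj n (x : 'S_n.+1) :
  ncycles x = (ncycles (canproj x) + (x ord_max == ord_max))%N.
Proof.
have E : lift_perm ord_max ord_max (canproj x) =
    (tperm ord_max ((x^-1)%g ord_max) * x)%g.
  apply/permP => k; rewrite permM.
  case: (unliftP ord_max k) => [j ->|->]; last first.
    by rewrite lift_perm_id tpermL permKV.
  have wE (i : 'I_n) : lift ord_max i = widen_ord (leqnSn n) i.
    by apply/val_inj; exact: lift_max.
  rewrite lift_perm_lift; apply/val_inj.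
  rewrite [LHS]lift_max permE canproj_funE -wE.
  have nm := neq_lift ord_max j; rewrite eq_sym in nm.
  case: tpermP => [e|e|_ ne]; first by rewrite e eqxx in nm.
    by rewrite e permKV ltnn.
  case: ltnP => // h; case: ne.
  apply: (@perm_inj _ x); rewrite permKV.
  by apply/val_inj/eqP; rewrite eqn_leq -ltnS ltn_ord.
have := porbits_mul_tperm x ord_max ((x^-1)%g ord_max); rewrite /= -E.
have -> : ord_max \in porbit x ((x^-1)%g ord_max).
  by rewrite -[X in X \in _](permKV x) (mem_porbit x 1).
rewrite /= addn0 [X in X = _]ncycles_lift_perm.
rewrite -{1}(permK x ord_max) (inj_eq perm_inj) => e.
by move: e; case: eqP => _ /= e; rewrite ?addn0 ?addn1 in e *; rewrite -?e //;
  case: e.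
Qed.

(** * The action and the cocycle *)

(** The action of g on S(n), which describes the action on virtual permutations
    level by level. *)
Definition act_perm n (g : Ginf) (s : 'S_n) : 'S_n :=
  (restr n g.1 * s * (restr n g.2)^-1)%g.

Lemma act_perm_inj n g : injective (@act_perm n g).
Proof. by move=> s s' /mulIg/mulgI. Qed.

Lemma vproj_vact n x g :
  in_G n g -> vproj n (vact x g) = act_perm n g (vproj n x).
Proof. exact: vactE. Qed.

Lemma restr_max n (f : Sinf) :
  fixes_from n f -> restr n.+1 f ord_max = ord_max.
Proof.
move=> fn; apply/val_inj; rewrite /= restrE /=; first exact: fn.
by move=> i /ltnW; exact: fn.
Qed.

(** The cocycle does not depend on the level: passing from n to n+1 adds a cycle
    exactly when the last point is fixed, and for g in G(n), which fixes that
    point, x and x . g agree on whether they fix it. *)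
Lemma ncycles_vact_cst (x : vperm) (g : Ginf) m n :
  in_G m g -> (m <= n)%N ->
  (ncycles (vproj n (vact x g)))%:Z - (ncycles (vproj n x))%:Z =
  (ncycles (vproj m (vact x g)))%:Z - (ncycles (vproj m x))%:Z.
Proof.
move=> gm; elim: n => [|n IH]; first by rewrite leqn0 => /eqP->.
rewrite leq_eqVlt => /predU1P[->//|]; rewrite ltnS => mn; rewrite -(IH mn).
have [h1 h2] := in_G_leq mn gm.
rewrite !ncycles_canproj !vproj_coherent.
suff -> : (vproj n.+1 (vact x g) ord_max == ord_max) =
          (vproj n.+1 x ord_max == ord_max).
  by rewrite !PoszD opprD addrACA subrr addr0.
rewrite vproj_vact; last by apply: in_GS; split.
rewrite /act_perm !permM restr_max //.
rewrite -(inj_eq (@perm_inj _ (restr n.+1 g.2))) permKV.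
by rewrite restr_max.
Qed.

Lemma cocycleE n (x : vperm) (g : Ginf) : in_G n g ->
  cocycle x g =
    (ncycles (act_perm n g (vproj n x)))%:Z - (ncycles (vproj n x))%:Z.
Proof.
move=> gn; rewrite -vproj_vact // /cocycle.
by case: (leqP n (level g)) => [nl|/ltnW ln];
  [|symmetry]; apply: ncycles_vact_cst => //; exact: levelP.
Qed.

Lemma sinf_inverse (f : Sinf) :
  exists f' : Sinf, cancel f f' /\ cancel f' f.
Proof.
have [h fK hK] := sinf_bij f; have [n fn] := sinf_fin f.
have hn : exists n, fixes_from n h by exists n => i /fn {1}<-; rewrite fK.
by exists (MkSinf (Bijective hK fK) hn).
Qed.

Lemma vperm_eq_from N (x y : vperm) :
  (forall n, (N <= n)%N -> vproj n x = vproj n y) -> x = y.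
Proof.
move=> e; suff e' n : vproj n x = vproj n y.
  by apply/val_inj/functional_extensionality_dep => n; exact: e'.
have [k] : exists k, (N <= k + n)%N by exists N; rewrite leq_addr.
elim: k n => [|k IH] n; first exact: e.
by rewrite addSnnS => /IH e'; rewrite -vproj_coherent e' vproj_coherent.
Qed.

Lemma fixes_from_can n (f f' : Sinf) :
  cancel f f' -> fixes_from n f -> fixes_from n f'.
Proof. by move=> fK fn i /fn {1}<-; rewrite fK. Qed.

Lemma restr_can n (f f' : Sinf) :
  cancel f f' -> fixes_from n f -> restr n f' = (restr n f)^-1%g.
Proof.
move=> fK fn; apply/esym/eqP; rewrite eq_invg_mul; apply/eqP/permP => i.
apply/val_inj; rewrite permM perm1 /= !restrE ?fK //.
exact: fixes_from_can fn.
Qed.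

(** Shifts are bijections, so that the shift of a set is a preimage; this is how
    shifted measures are handled below. *)
Lemma vact_inverse (g : Ginf) :
  exists h : Ginf, cancel (vact^~ g) (vact^~ h) /\ cancel (vact^~ h) (vact^~ g).
Proof.
case: g => g1 g2.
have [h1 [g1K h1K]] := sinf_inverse g1; have [h2 [g2K h2K]] := sinf_inverse g2.
have [N gN] := in_G_ex (g1, g2).
have hN n : (N <= n)%N -> in_G n (g1, g2) /\ in_G n (h1, h2).
  move=> Nn; have [fg1 fg2] := in_G_leq Nn gN.
  by do 2![split=> //]; [exact: fixes_from_can fg1|exact: fixes_from_can fg2].
exists (h1, h2); split=> x; apply: (vperm_eq_from N) => n /hN [gn hn];
  rewrite !vproj_vact // /act_perm /= (restr_can _ _ _ g1K gn.1);
  rewrite (restr_can _ _ _ g2K gn.2) ?invgK !mulgA; [rewrite mulVg|rewrite mulgV];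
  by rewrite mul1g -mulgA ?mulVg ?mulgV mulg1.
Qed.

Lemma restr_surj n (s : 'S_n) : exists f : Sinf, fixes_from n f /\ restr n f = s.
Proof.
pose F (u : 'S_n) (i : nat) : nat := if insub i is Some j then u j else i.
have FE u (i : 'I_n) : F u i = u i by rewrite /F valK.
have Fn u : fixes_from n (F u).
  by move=> i ni; rewrite /F insubF // ltnNge ni.
have FK (u v : 'S_n) : (u * v = 1)%g -> cancel (F u) (F v).
  move=> uv i; have [ilt|ige] := ltnP i n; last by rewrite !Fn.
  by rewrite -[i]/(nat_of_ord (Ordinal ilt)) !FE -permM uv perm1.
pose f := MkSinf (Bijective (FK _ _ (mulgV s)) (FK _ _ (mulVg s)))
  (ex_intro _ n (Fn s)).
exists f; split; first exact: Fn.
by apply/permP => i; apply/val_inj; rewrite /= restrE; [exact: FE|exact: Fn].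
Qed.

(** G(n) acts transitively on S(n), already through its first factor. *)
Lemma act_perm_transitive n (s s' : 'S_n) :
  exists g : Ginf, in_G n g /\ act_perm n g s = s'.
Proof.
have [f [fn fE]] := restr_surj n (s' * s^-1)%g.
have [e [en eE]] := restr_surj n 1%g.
exists (f, e); split; first by split.
by rewrite /act_perm fE eE invg1 mulg1 mulgKV.
Qed.

(** * Cylinders and Borel sets *)

(** A set described by the level m is also described by every level n >= m, which
    is why arguments on cylinders may start at an arbitrarily high level. *)
Lemma vproj_factor m n : (m <= n)%N ->
  exists p : 'S_n -> 'S_m, forall x, vproj m x = p (vproj n x).
Proof.
elim: n => [|n IH]; first by rewrite leqn0 => /eqP->; exists id.
rewrite leq_eqVlt => /predU1P[->|]; first by exists id.
rewrite ltnS => /IH[p pE]; exists (p \o @canproj n) => x /=.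
by rewrite vproj_coherent.
Qed.

Lemma vproj_continuous n :
  continuous (vproj n : vperm -> discrete_topology 'S_n).
Proof.
move=> x; apply: (@continuous_comp _ _ _ (val : vperm -> _)
  (fun f : prod_topology (fun n : nat => discrete_topology 'S_n) => f n)).
  exact: initial_continuous.
exact: (@proj_continuous _ (fun n : nat => discrete_topology 'S_n) n).
Qed.

Lemma open_vproj n (A : set 'S_n) : open (vproj n @^-1` A).
Proof.
move/continuousP: (@vproj_continuous n) => /(_ A); apply.
exact: discrete_open.
Qed.

(** The fibers of the projections form a base of the topology: an open set of the
    product constrains finitely many coordinates, and these are functions of
    the coordinate of largest index. *)
Lemma open_fiber (U : set vperm) (x : vperm) : open U -> U x ->
  exists n, vproj n @^-1` [set vproj n x] `<=` U.
Proof.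
pose P := prod_topology (fun n : nat => discrete_topology 'S_n).
move=> oU Ux.
have [W oW WU] : exists2 W : set P, open W & val @^-1` W = U by [].
(* The filter generated by the conditions on finitely many initial coordinates
   of x; it converges to x because it does so coordinatewise. *)
pose F : set_system P :=
  [set A | exists n, forall y, (forall k, (k <= n)%N -> y k = val x k) -> A y].
have FF : Filter F.
  split.
  - by exists 0%N.
  - move=> A B [m Am] [n Bn]; exists (maxn m n) => y yx; split.
      by apply: Am => k km; apply: yx; rewrite leq_max km.
    by apply: Bn => k kn; apply: yx; rewrite leq_max kn orbT.
  - by move=> A B AB [m Am]; exists m => y /Am /AB.
have Fx : F --> (val x : P).
  apply/cvg_sup => i A [_ [[B _ <-] Bx] BA].
  by exists i => y yx; apply: BA; rewrite /= yx.
have [|n Wn] := Fx W.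
  by apply: open_nbhs_nbhs; split=> //; rewrite -WU in Ux.
exists n => y yx; rewrite -WU; apply: Wn => k kn.
have [p pE] := vproj_factor _ _ kn.
by rewrite -[LHS]/(vproj k y) -[RHS]/(vproj k x) !pE yx.
Qed.

Definition cylinder : set (set vperm) :=
  [set V | exists n (A : {set 'S_n}), V = vproj n @^-1` [set` A]].

Lemma cylinder_preimage n (A : set 'S_n) : cylinder (vproj n @^-1` A).
Proof.
by exists n, [set s | s \in A]%SET; apply/seteqP; split=> x /=; rewrite !inE.
Qed.

Lemma cylinder_level N V : cylinder V ->
  exists n (A : {set 'S_n}), (N <= n)%N /\ V = vproj n @^-1` [set` A].
Proof.
move=> [m [A ->]]; have [p pE] := vproj_factor _ _ (leq_maxr N m).
exists (maxn N m), (p @^-1: A)%SET; split; first exact: leq_maxl.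
by apply/seteqP; split=> x /=; rewrite !inE pE.
Qed.

Lemma cylinder_setI : setI_closed cylinder.
Proof.
move=> V W [m [A ->]] /(cylinder_level m)[n [B [mn ->]]].
have [p pE] := vproj_factor _ _ mn.
rewrite (_ : _ `&` _ = vproj n @^-1` (p @^-1` [set` A] `&` [set` B])).
  exact: cylinder_preimage.
by apply/seteqP; split=> x /=; rewrite pE.
Qed.

Lemma measurable_vproj n (A : set 'S_n) : measurable (vproj n @^-1` A).
Proof. by apply: sub_sigma_algebra; exact: open_vproj. Qed.

(** There are only finitely many fibers at each level, so an open set, being a
    union of fibers, is a countable union of cylinders. *)
Lemma measurable_vpermE : measurable = <<s cylinder >>.
Proof.
apply/seteqP; split; last first.
  apply: smallest_sub; first exact: sigma_algebra_measurable.
  by move=> _ [n [A ->]]; exact: measurable_vproj.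
apply: smallest_sub; first exact: smallest_sigma_algebra.
move=> U oU.
(* The n-th set of the union is the largest subset of U described by level n. *)
rewrite (_ : U =
    \bigcup_n (vproj n @^-1` [set s | vproj n @^-1` [set s] `<=` U])).
  apply: (@sigma_algebra_bigcup _ setT cylinder) => n.
  by apply: sub_sigma_algebra; exact: cylinder_preimage.
apply/seteqP; split=> [x Ux|x [n _]]; last exact.
by have [n nU] := open_fiber _ _ oU Ux; exists n.
Qed.

Lemma measurable_vact g : measurable_fun setT (vact^~ g).
Proof.
move=> _ W mW; rewrite setTI.
have [N gN] := in_G_ex g.
suff: measurable `<=` [set W | measurable (vact^~ g @^-1` W)] by exact.
rewrite [X in X `<=` _]measurable_vpermE; apply: smallest_sub.
  split=> [|A mA|A mA] /=.
  - by rewrite preimage_set0; exact: measurable0.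
  - by rewrite setTD preimage_setC; exact: measurableC.
  - by rewrite preimage_bigcup; exact: bigcupT_measurable.
move=> V /(cylinder_level N)[n [A [Nn ->]]] /=.
rewrite (_ : _ @^-1` _ = vproj n @^-1` (act_perm n g @^-1` [set` A])).
  exact: measurable_vproj.
apply/seteqP; split=> x /=; rewrite vproj_vact //; exact: in_G_leq gN.
Qed.

Lemma measurable_fun_vproj (R : realType) n (F : 'S_n -> R) :
  measurable_fun setT (F \o vproj n).
Proof.
by move=> _ B _; rewrite setTI comp_preimage; exact: measurable_vproj.
Qed.

Lemma measure_vproj (R : realType) (m : {measure set vperm -> \bar R}) n
    (A : {set 'S_n}) :
  m (vproj n @^-1` [set` A]) = (\sum_(s in A) m (vproj n @^-1` [set s]))%E.
Proof.
have AE : [set` A] = [set` enum A].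
  by apply/seteqP; split=> s /=; rewrite mem_enum.
rewrite -big_enum /= fsbig_seq ?enum_uniq // -AE.
rewrite -content_fin_bigcup.
- congr (m _).
  by apply/seteqP; split=> [x /= xA|x [s /= sA ->]//]; exists (vproj n x).
- exact: finite_finset.
- by move=> s s' _ _ [x [/= -> ->]].
- by move=> s _; exact: measurable_vproj.
- apply: fin_bigcup_measurable => [|s _]; first exact: finite_finset.
  exact: measurable_vproj.
Qed.

(** A finite measure is determined by its values on the fibers of high level: they
    give its values on cylinders, which form a generating pi-system. *)
Lemma measure_eq_fibers (R : realType) (m1 m2 : {measure set vperm -> \bar R}) N :
  (m1 setT < +oo)%E ->
  (forall n (s : 'S_n), (N <= n)%N ->
    m1 (vproj n @^-1` [set s]) = m2 (vproj n @^-1` [set s])) ->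
  forall V, measurable V -> m1 V = m2 V.
Proof.
move=> m1oo m12 V; apply: (measure_unique cylinder (fun=> setT)) => //.
- exact: measurable_vpermE.
- exact: cylinder_setI.
- by move=> _; exact: (@cylinder_preimage 0 setT).
- by rewrite bigcup_const.
- move=> _ /(cylinder_level N)[n [A [Nn ->]]].
  by rewrite !measure_vproj; apply: eq_bigr => s _; exact: m12.
Qed.

Lemma vshift_preimage g h V :
  cancel (vact^~ g) (vact^~ h) -> cancel (vact^~ h) (vact^~ g) ->
  vshift V g = vact^~ h @^-1` V.
Proof.
move=> gK hK; apply/seteqP; split=> [_ [x Vx <-]|y Vy] /=; first by rewrite gK.
by exists (vact y h) => //; exact: hK.
Qed.

Lemma measurable_vshift g V : measurable V -> measurable (vshift V g).
Proof.
move=> mV; have [h [gK hK]] := vact_inverse g.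
by rewrite (vshift_preimage _ _ _ gK hK) -[X in measurable X]setTI;
  exact: measurable_vact.
Qed.

Lemma vshift_fiber n g (s : 'S_n) : in_G n g ->
  vshift (vproj n @^-1` [set s]) g = vproj n @^-1` [set act_perm n g s].
Proof.
move=> gn; have [h [gK hK]] := vact_inverse g.
apply/seteqP; split=> [_ [x /= <- <-]|y /= yE]; first exact: vproj_vact.
exists (vact y h) => /=; last exact: hK.
by apply: (@act_perm_inj n g); rewrite -vproj_vact // hK.
Qed.

(** * The density of a shifted Ewens measure *)

Section density_measure.
Context d (T : measurableType d) (R : realType).
Variables (m : {measure set T -> \bar R}) (f : T -> \bar R).
Hypotheses (mf : measurable_fun setT f) (f_ge0 : forall x, (0 <= f x)%E).

(** The measure with density f; the two proofs are arguments so that the measure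
    structure can be inferred from the term. *)
Definition density_measure of measurable_fun setT f & (forall x, (0 <= f x)%E)
    : set T -> \bar R :=
  fun V => (\int[m]_(x in V) f x)%E.

Local Notation nu := (density_measure mf f_ge0).

Let nu0 : nu set0 = 0%E. Proof. exact: integral_set0. Qed.

Let nu_ge0 V : (0 <= nu V)%E. Proof. by apply: integral_ge0 => x _. Qed.

Let nu_sigma_additive : semi_sigma_additive nu.
Proof. exact: semi_sigma_additive_nng_induced. Qed.

HB.instance Definition _ :=
  isMeasure.Build _ _ _ nu nu0 nu_ge0 nu_sigma_additive.

End density_measure.

Section ewens_shift.
Context (R : realType) (t : R) (m : probability vperm R).
Hypotheses (t_gt0 : 0 < t) (mE : is_ewens_limit t m).

Lemma ewens_fiber n (s : 'S_n) : m (vproj n @^-1` [set s]) = (ewens t s)%:E.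
Proof.
have -> : [set s] = [set` [set s]%SET].
  by apply/seteqP; split=> u; rewrite /= inE => /eqP.
by rewrite mE big_set1.
Qed.

(** The normalizing factor depends only on n, so the ratio of the weights of two
    permutations of S(n) is a power of t; this is where the cocycle comes from. *)
Lemma ewens_act_perm n g (s : 'S_n) :
  ewens t (act_perm n g s) =
  t ^ ((ncycles (act_perm n g s))%:Z - (ncycles s)%:Z) * ewens t s.
Proof.
by rewrite /ewens mulrA (exprnP t (ncycles s)) -expfzDr ?gt_eqF // subrK -exprnP.
Qed.

Lemma measurable_cocycle g :
  measurable_fun setT (fun x => (t ^ cocycle x g)%:E : \bar R).
Proof.
have [N gN] := in_G_ex g; apply/measurable_EFinP.
rewrite (_ : (fun _ => _) = (fun s =>
    t ^ ((ncycles (act_perm N g s))%:Z - (ncycles s)%:Z)) \o vproj N).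
  exact: measurable_fun_vproj.
by apply/funext => x /=; rewrite (cocycleE N).
Qed.

(** Both sides are measures in V, and on a fiber of a level n with g in G(n) they
    agree: the cocycle is constant there and the shift is again a fiber of the
    same level. *)
Lemma ewens_vshift g V : measurable V ->
  m (vshift V g) = (\int[m]_(x in V) (t ^ cocycle x g)%:E)%E.
Proof.
move=> mV; have [N gN] := in_G_ex g; have [h [gK hK]] := vact_inverse g.
have f0 x : (0 <= (t ^ cocycle x g)%:E :> \bar R)%E.
  by rewrite lee_fin exprz_ge0 // ltW.
pose nu := density_measure _ _ _ m _ (measurable_cocycle g) f0.
have mh := measurable_vact h.
pose shiftm := pushforward m (vact^~ h).
rewrite (vshift_preimage _ _ _ gK hK) -[LHS]/(shiftm V) -[RHS]/(nu V).
apply: (measure_eq_fibers _ _ _ N) mV => [|n s Nn].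
  by rewrite /= /pushforward preimage_setT probability_setT ltry.
have gn := in_G_leq Nn gN.
rewrite /= /shiftm /nu /pushforward /density_measure.
rewrite -(vshift_preimage _ _ _ gK hK) vshift_fiber //.
rewrite [LHS]ewens_fiber ewens_act_perm EFinM.
under eq_integral => x.
  rewrite inE /= => xs; rewrite (cocycleE n) // xs.
  over.
by rewrite -ewens_fiber integral_cst //; exact: measurable_vproj.
Qed.

(** One direction is read off the density formula for g.  For the other, B is the
    shift of B . g by the inverse of g, so the same formula applies. *)
Lemma ewens_quasiinvariant : quasiinvariant m.
Proof.
move=> g; split=> V nullV B mB BV.
- have [h [gK hK]] := vact_inverse g.
  have -> : B = vshift (vshift B g) h.
    by rewrite (vshift_preimage _ _ _ hK gK) (vshift_preimage _ _ _ gK hK);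
      apply/seteqP; split=> x /=; rewrite gK.
  rewrite ewens_vshift; last exact: measurable_vshift.
  apply: null_set_integral; last exact: nullV.
  + exact: measurable_vshift.
  + by apply: measurable_funTS; exact: measurable_cocycle.
- rewrite /shift_measure ewens_vshift //.
  apply: null_set_integral => //; last exact: nullV.
  by apply: measurable_funTS; exact: measurable_cocycle.
Qed.

End ewens_shift.

(** * Quasiinvariance and the degenerate limits *)

(** Since G(n) permutes the fibers of level n transitively, one null fiber would
    make all of them null, and finitely many null sets would cover the space. *)
Lemma quasiinvariant_fiber_neq0 (R : realType) (m : probability vperm R) n
    (s : 'S_n) :
  quasiinvariant m -> m (vproj n @^-1` [set s]) <> 0%E.
Proof.
move=> qm ms0.
have fiber0 s' : m (vproj n @^-1` [set s']) = 0%E.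
  have [g [gn <-]] := act_perm_transitive n s s'.
  rewrite -vshift_fiber //; have ms := measurable_vproj n [set s].
  have null_s : m.-null_set (vproj n @^-1` [set s]).
    by apply/measure0_null_setP.
  exact: ((qm g).2 _ null_s _ ms).
have := probability_setT m.
rewrite (_ : setT = vproj n @^-1` [set` [set: 'S_n]%SET]); last first.
  by apply/seteqP; split=> x //= _; rewrite inE.
rewrite measure_vproj big1 => [/esym/eqP|s' _]; last exact: fiber0.
by rewrite onee_eq0.
Qed.

(** Fibers are open, so every function of a coordinate is a test function for weak
    convergence. *)
Lemma continuous_vproj_comp (R : realType) n (F : 'S_n -> R) :
  continuous (F \o vproj n).
Proof.
by apply/continuousP => B _; rewrite comp_preimage; exact: open_vproj.
Qed.

Lemma weak_limit_fiber (R : realType) (mu : R -> probability vperm R)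
    (F : set_system R) (nu : probability vperm R) n (s : 'S_n) :
  weak_limit mu F nu ->
  mu t (vproj n @^-1` [set s]) @[t --> F] --> nu (vproj n @^-1` [set s]).
Proof.
pose f : vperm -> R := \1_(vproj n @^-1` [set s]).
have intf (m : probability vperm R) :
    (\int[m]_x (f x)%:E)%E = m (vproj n @^-1` [set s]).
  by rewrite integral_indic ?setIT //; exact: measurable_vproj.
move=> /(_ f).
rewrite (_ : (fun t => _) = (fun t => mu t (vproj n @^-1` [set s]))).
  rewrite intf; apply.
    exact: (@continuous_vproj_comp R n (fun u => \1_[set s] u)).
  exists 1; split=> // M M1 x _ /=.
  by rewrite /f indicE ger0_norm // (le_trans _ (ltW M1)) // lern1 leq_b1.
by apply/funext => t; exact: intf.
Qed.

Lemma ncycles_S2 (s : 'S_2) : ncycles s = (s ord_max == ord_max).+1.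
Proof.
have ncycles_S0 (u : 'S_0) : ncycles u = 0%N.
  apply/eqP; rewrite -leqn0 -[X in (_ <= X)%N](card_ord 0).
  exact: leq_imset_card.
have fix_max (u : 'S_1) : u ord_max = ord_max by rewrite ord1 [RHS]ord1.
by rewrite !ncycles_canproj ncycles_S0 fix_max eqxx.
Qed.

Lemma ewens_S2 (R : realType) (t : R) (s : 'S_2) : 0 < t ->
  ewens t s = t ^+ (s ord_max == ord_max) / (t + 1).
Proof.
move=> t0; rewrite /ewens ncycles_S2 !big_ord_recl big_ord0 /= addr0 mulr1.
by rewrite exprS invfM mulrACA divff ?mul1r // gt_eqF.
Qed.

(** The bound e lets the two degenerate limits be treated alike. *)
Lemma weak_limit_ewens_fiber0 (R : realType) (mu : R -> probability vperm R)
    (F : set_system R) (nu : probability vperm R) n (s : 'S_n) (e : R -> R) :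
  ProperFilter F -> weak_limit mu F nu ->
  (\forall t \near F, is_ewens_limit t (mu t) /\ 0 <= ewens t s <= e t) ->
  e t @[t --> F] --> 0 ->
  nu (vproj n @^-1` [set s]) = 0%E.
Proof.
move=> PF lim_nu near_e e0.
have lim_fiber := weak_limit_fiber _ _ _ _ n s lim_nu.
apply: (cvg_unique _ lim_fiber) => //.
have /near_eq_cvg/cvg_trans : {near F, (fun t => (ewens t s)%:E) =1
    (fun t => mu t (vproj n @^-1` [set s]))}.
  by apply: filterS near_e => t [/ewens_fiber].
apply.
apply: cvg_EFin; first exact: nearW.
apply: squeeze_cvgr (cvg_cst 0) e0 => /=.
by apply: filterS near_e => t [].
Qed.

(** As t tends to 0, the weight t/(t+1) of the identity of S(2) tends to 0. *)
Lemma weak_limit0_not_quasiinvariant (R : realType)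
    (mu : R -> probability vperm R) (mu0 : probability vperm R) :
  (forall t, 0 < t -> is_ewens_limit t (mu t)) ->
  weak_limit mu (0 : R)^'+ mu0 -> ~ quasiinvariant mu0.
Proof.
move=> muE lim0 /(@quasiinvariant_fiber_neq0 R mu0 2 1%g); apply.
apply: (weak_limit_ewens_fiber0 _ mu _ _ _ _ id _ lim0).
  near=> t; have t0 : 0 < t by near: t; exact: nbhs_right_gt.
  split; first exact: muE.
  rewrite ewens_S2 // perm1 eqxx expr1.
  have t1 : 0 < t + 1 by rewrite addr_gt0.
  apply/andP; split; first by rewrite divr_ge0 // ltW.
  by rewrite ler_pdivrMr // mulrDr mulr1 lerDr ltW // mulr_gt0.
exact/cvg_at_right_filter/cvg_id.
Unshelve. all: by end_near.
Qed.

(** As t tends to infinity, the weight 1/(t+1) of the transposition of S(2) tends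
    to 0. *)
Lemma weak_limitoo_not_quasiinvariant (R : realType)
    (mu : R -> probability vperm R) (muoo : probability vperm R) :
  (forall t, 0 < t -> is_ewens_limit t (mu t)) ->
  weak_limit mu +oo%R muoo -> ~ quasiinvariant muoo.
Proof.
move=> muE limoo; pose s : 'S_2 := tperm ord0 ord_max.
move/(@quasiinvariant_fiber_neq0 R muoo 2 s); apply.
apply: (weak_limit_ewens_fiber0 _ mu _ _ _ _ (fun t => t^-1) _ limoo).
  near=> t; have t0 : 0 < t by near: t; exact: nbhs_pinfty_gt.
  split; first exact: muE.
  rewrite ewens_S2 // tpermR /= expr0 div1r.
  have t1 : 0 < t + 1 by rewrite addr_gt0.
  by rewrite invr_ge0 (ltW t1) /= lef_pV2 ?posrE // lerDl.
apply/gtr0_cvgV0; last exact: cvg_id.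
exact: nbhs_pinfty_gt.
Unshelve. all: by end_near.
Qed.

Theorem proposition2p5p1 (R : realType) (mu : R -> probability vperm R)
    (mu0 muoo : probability vperm R)
    (mu_ewens : forall t : R, 0 < t -> is_ewens_limit t (mu t))
    (mu0_lim : weak_limit mu (0 : R)^'+ mu0)
    (muoo_lim : weak_limit mu +oo%R muoo) :
  [/\ forall t : R, 0 < t ->
        quasiinvariant (mu t) /\
        forall (g : Ginf) (V : set vperm), measurable V ->
          mu t (vshift V g) = (\int[mu t]_(x in V) (t ^ cocycle x g)%:E)%E,
      ~ quasiinvariant mu0 &
      ~ quasiinvariant muoo].
Proof.
split=> [t t0||].
- have muE := mu_ewens _ t0; split; first exact: ewens_quasiinvariant muE.
  by move=> g V; exact: ewens_vshift.
- exact: weak_limit0_not_quasiinvariant mu_ewens mu0_lim.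
- exact: weak_limitoo_not_quasiinvariant mu_ewens muoo_lim.
Qed.
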